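(* Let $G$ be a group given by an extension $$1\longrightarrow K\longrightarrow G\stackrel{\rho}{\longrightarrow} Q\longrightarrow 1$$ where $K$ is a non-trivial word hyperbolic group, and let $\theta:Q\longrightarrow \mathrm{Out}(K)$ be the associated homomorphism. Then $G$ is icc if and only if both of the following conditions hold: (i) $K$ is icc; (ii) the induced homomorphism $\theta:FC(Q)\longrightarrow \mathrm{Out}(K)$ (the restriction of $\theta$ to $FC(Q)$) is injective.
   Context: A group is said to be icc (with infinite conjugacy classes) if it is non-trivial and all its conjugacy classes other than $\{1\}$ are infinite. For a group $H$, $FC(H)$ denotes the union of the finite conjugacy classes of $H$; it is a characteristic subgroup of $H$. Word hyperbolic is meant in the sense of Gromov. $K$ is identified with its image, a normal subgroup of $G$. For $u,g\in G$, $u^g=g^{-1}ug$, and $\pi:G\to \mathrm{Aut}(K)$ is the homomorphism defined by $\pi(g)(k)=k^g$ (automorphisms being composed as right actions). $\mathrm{Out}(K)=\mathrm{Aut}(K)/\mathrm{Inn}(K)$, and the associated homomorphism $\theta:Q\to\mathrm{Out}(K)$ sends $q\in Q$ to the class of $\pi(g)$ in $\mathrm{Out}(K)$, for any $g\in G$ with $\rho(g)=q$. *)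

(* Defs.v *)
From HB Require Import structures.
From mathcomp Require Import all_boot all_order all_algebra.
From mathcomp Require Import boolp classical_sets functions cardinality.

Set Implicit Arguments.
Unset Strict Implicit.
Unset Printing Implicit Defensive.

Local Open Scope classical_set_scope.
Local Open Scope quotient_scope.
Local Open Scope group_scope.

Lemma group_monoid_morphism (G H : groupType) (f : G -> H) :
  {morph f : x y / x * y} -> monoid_morphism f.
Proof. by move=> fM; split=> //; apply: (mulgI (f 1)); rewrite -fM !mulg1. Qed.

Section ConjugacyClasses.
Variable G : groupType.

Definition conj_class (g : G) : set G := [set g ^ x | x in [set: G]].

Definition nontrivial_group : Prop := exists g : G, g <> 1.

Definition icc : Prop :=
  nontrivial_group /\ forall g : G, g <> 1 -> infinite_set (conj_class g).

Definition FC : set G :=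
  \bigcup_(g in [set g | finite_set (conj_class g)]) conj_class g.

End ConjugacyClasses.

Arguments nontrivial_group : clear implicits.
Arguments icc : clear implicits.
Arguments FC : clear implicits.

Section WordMetric.
Variables (G : groupType) (S : seq G).

Definition is_word (w : seq G) : bool :=
  all (fun s => (s \in S) || (s^-1 \in S)) w.

Definition word_of_size (g : G) (n : nat) : Prop :=
  exists w : seq G, [/\ is_word w, size w = n & \prod_(s <- w) s = g].

Definition generating : Prop := forall g : G, exists n, word_of_size g n.

Hypothesis genS : generating.

Lemma word_lengthP (g : G) : exists n, `[< word_of_size g n >].
Proof. by have [n ?] := genS g; exists n; apply/asboolP. Qed.

Definition word_length (g : G) : nat := ex_minn (word_lengthP g).

Definition word_dist (x y : G) : nat := word_length (x^-1 * y).

End WordMetric.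

(* Distances are integers, so Gromov products are half-integers, and it is no
   restriction to look for the hyperbolicity constant in [rat]. *)
Definition gromov_product (T : Type) (d : T -> T -> nat) (w x y : T) : rat :=
  (((d x w)%:R + (d y w)%:R - (d x y)%:R) / 2%:R)%R.

Definition gromov_hyperbolic (T : Type) (d : T -> T -> nat) : Prop :=
  exists2 delta : rat, (0 <= delta)%R & forall w x y z : T,
    (Num.min (gromov_product d w x y) (gromov_product d w y z) - delta
       <= gromov_product d w x z)%R.

Definition word_hyperbolic (G : groupType) : Prop :=
  exists (S : seq G) (genS : generating S), gromov_hyperbolic (word_dist genS).

Section Automorphisms.
Variable K : groupType.

Definition is_aut (f : K -> K) : Prop :=
  bijective f /\ {morph f : x y / x * y}.

Record Aut := MkAut { aut_fun :> K -> K; aut_boolP : `[< is_aut aut_fun >] }.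

HB.instance Definition _ := [isSub for aut_fun].
HB.instance Definition _ := [Choice of Aut by <:].

Lemma autP (f : Aut) : is_aut f.
Proof. exact/asboolP/(aut_boolP f). Qed.

Definition mk_aut (f : K -> K) (Hf : is_aut f) : Aut :=
  MkAut (introT (asboolP _) Hf).

Lemma aut_eqP (f g : Aut) : f =1 g -> f = g.
Proof. by move=> fg; apply: val_inj; apply: funext. Qed.

Lemma aut_id_subproof : is_aut id.
Proof. by split=> //; exists id. Qed.

Lemma aut_comp_subproof (f g : Aut) : is_aut (g \o f).
Proof.
have [bf mf] := autP f; have [bg mg] := autP g; split; first exact: bij_comp.
by move=> x y /=; rewrite mf mg.
Qed.

Lemma aut_inv_subproof (f : Aut) :
  exists g : Aut, cancel f g /\ cancel g f.
Proof.
have [[h fK hK] mf] := autP f.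
have ah : is_aut h.
  split; first by exists f.
  by move=> x y; rewrite -{1}(hK x) -{1}(hK y) -mf fK.
by exists (mk_aut ah).
Qed.

Definition aut_one : Aut := mk_aut aut_id_subproof.
(* Right actions: [f * g] is [f] followed by [g]. *)
Definition aut_mul (f g : Aut) : Aut := mk_aut (aut_comp_subproof f g).
Definition aut_inv (f : Aut) : Aut := projT1 (cid (aut_inv_subproof f)).

Lemma aut_invK (f : Aut) : cancel f (aut_inv f) /\ cancel (aut_inv f) f.
Proof. exact: (projT2 (cid (aut_inv_subproof f))). Qed.

Lemma aut_mulA : associative aut_mul.
Proof. by move=> f g h; apply: aut_eqP. Qed.
Lemma aut_mul1g : left_id aut_one aut_mul.
Proof. by move=> f; apply: aut_eqP. Qed.
Lemma aut_mulg1 : right_id aut_one aut_mul.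
Proof. by move=> f; apply: aut_eqP. Qed.
Lemma aut_mulVg : left_inverse aut_one aut_inv aut_mul.
Proof. by move=> f; apply: aut_eqP => x; apply: (aut_invK f).2. Qed.
Lemma aut_mulgV : right_inverse aut_one aut_inv aut_mul.
Proof. by move=> f; apply: aut_eqP => x; apply: (aut_invK f).1. Qed.

HB.instance Definition _ :=
  isGroup.Build Aut aut_mulA aut_mul1g aut_mulg1 aut_mulVg aut_mulgV.

Lemma autM (f g : Aut) x : (f * g) x = g (f x).
Proof. by []. Qed.

Lemma inner_subproof (k : K) : is_aut (fun x => x ^ k).
Proof.
split; last by move=> x y; rewrite conjMg.
by exists (fun x => x ^ k^-1) => x; rewrite (conjgK, conjgKV).
Qed.

Definition inner (k : K) : Aut := mk_aut (inner_subproof k).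

Definition Inn : set Aut := range inner.

Lemma Inn1 : Inn 1.
Proof. by exists 1 => //; apply: aut_eqP => x /=; rewrite conjg1. Qed.

Lemma InnM f g : Inn f -> Inn g -> Inn (f * g).
Proof.
case=> a _ <- [b _ <-]; exists (a * b) => //.
by apply: aut_eqP => x; rewrite autM /= conjgM.
Qed.

Lemma InnV f : Inn f -> Inn f^-1.
Proof.
case=> a _ <-; exists a^-1 => //.
apply: (mulgI (inner a)); rewrite mulgV.
by apply: aut_eqP => x; rewrite autM /= conjgK.
Qed.

Lemma InnJ f g : Inn f -> Inn (f ^ g).
Proof.
case=> a _ <-; exists (g a) => //.
apply: (mulgI g); rewrite /conjg mulVKg.
apply: aut_eqP => x; rewrite !autM /= /conjg.
have gM := (autP g).2.
have g1 := (group_monoid_morphism gM).1.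
have -> : (g a)^-1 = g a^-1.
  by apply: (mulgI (g a)); rewrite mulgV -gM mulgV g1.
by rewrite -!gM.
Qed.

Definition Inn_rel (f g : Aut) : bool := `[< Inn (f^-1 * g) >].

Lemma Inn_rel_refl : reflexive Inn_rel.
Proof. by move=> f; apply/asboolP; rewrite mulVg; apply: Inn1. Qed.

Lemma Inn_rel_sym : symmetric Inn_rel.
Proof.
have sub f g : Inn_rel f g -> Inn_rel g f.
  by move=> /asboolP/InnV; rewrite invgM invgK => ?; apply/asboolP.
by move=> f g; apply/idP/idP; apply: sub.
Qed.

Lemma Inn_rel_trans : transitive Inn_rel.
Proof.
move=> g f h /asboolP fg /asboolP gh; apply/asboolP.
by have := InnM fg gh; rewrite mulgA mulgK.
Qed.

Canonical Inn_equiv := EquivRel Inn_rel Inn_rel_refl Inn_rel_sym Inn_rel_trans.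

Definition Out := {eq_quot Inn_rel}.
HB.instance Definition _ := Choice.on Out.
HB.instance Definition _ := EqQuotient.on Out.

Definition out_class (f : Aut) : Out := \pi_Out f.

Lemma out_classP f g : out_class f = out_class g <-> Inn (f^-1 * g).
Proof.
rewrite /out_class; split.
  by move/eqP; rewrite eqmodE => /asboolP.
by move=> fg; apply/eqP; rewrite eqmodE; apply/asboolP.
Qed.

Lemma out_classK (x : Out) : out_class (repr x) = x.
Proof. exact: reprK. Qed.

Definition out_one : Out := out_class 1.
Definition out_mul (x y : Out) : Out := out_class (repr x * repr y).
Definition out_inv (x : Out) : Out := out_class (repr x)^-1.

Lemma out_mulE f g : out_mul (out_class f) (out_class g) = out_class (f * g).
Proof.
have /out_classP := out_classK (out_class f); set f' := repr _ => ff'.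
have /out_classP := out_classK (out_class g); set g' := repr _ => gg'.
apply/out_classP; rewrite -/f' -/g'.
have -> : (f' * g')^-1 * (f * g) = (f'^-1 * f) ^ g' * (g'^-1 * g).
  by rewrite /conjg invgM !mulgA mulgK.
exact: InnM (InnJ _ ff') gg'.
Qed.

Lemma out_invE f : out_inv (out_class f) = out_class f^-1.
Proof.
have /out_classP := out_classK (out_class f); set f' := repr _ => ff'.
apply/out_classP; rewrite -/f' invgK.
have -> : f' * f^-1 = ((f'^-1 * f) ^ f'^-1)^-1.
  by rewrite /conjg invgK !mulgA mulgV mul1g invgM invgK.
exact/InnV/InnJ.
Qed.

Lemma out_mulA : associative out_mul.
Proof.
move=> x y z; rewrite -(out_classK x) -(out_classK y) -(out_classK z).
by rewrite !out_mulE mulgA.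
Qed.
Lemma out_mul1g : left_id out_one out_mul.
Proof. by move=> x; rewrite -(out_classK x) out_mulE mul1g. Qed.
Lemma out_mulg1 : right_id out_one out_mul.
Proof. by move=> x; rewrite -(out_classK x) out_mulE mulg1. Qed.
Lemma out_mulVg : left_inverse out_one out_inv out_mul.
Proof. by move=> x; rewrite -(out_classK x) out_invE out_mulE mulVg. Qed.
Lemma out_mulgV : right_inverse out_one out_inv out_mul.
Proof. by move=> x; rewrite -(out_classK x) out_invE out_mulE mulgV. Qed.

HB.instance Definition _ :=
  isGroup.Build Out out_mulA out_mul1g out_mulg1 out_mulVg out_mulgV.

Lemma out_classM : {morph out_class : f g / f * g}.
Proof. by move=> f g; rewrite -out_mulE. Qed.

HB.instance Definition _ :=
  isUMagmaMorphism.Build Aut Out out_class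
    (group_monoid_morphism out_classM).

End Automorphisms.

Record group_extension (K G Q : groupType) := GroupExtension {
  ext_inj : UMagmaMorphism.type K G;
  ext_proj : UMagmaMorphism.type G Q;
  ext_injI : injective ext_inj;
  ext_proj_surj : forall q : Q, exists g : G, ext_proj g = q;
  ext_exact : forall g : G, ext_proj g = 1 <-> exists k : K, ext_inj k = g
}.

Section ExtensionAction.
Variables (K G Q : groupType) (E : group_extension K G Q).
Local Notation iota := (ext_inj E).
Local Notation rho := (ext_proj E).

Lemma ext_conj_subproof (g : G) (k : K) :
  exists k' : K, iota k' = iota k ^ g.
Proof.
apply/(ext_exact E); rewrite /conjg !gmulfM.
have -> : rho (iota k) = 1 by apply/(ext_exact E); exists k.
by rewrite mul1g -gmulfM mulVg gmulf1.
Qed.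

Definition ext_conj_fun (g : G) (k : K) : K :=
  projT1 (cid (ext_conj_subproof g k)).

Lemma ext_conj_funE g k : iota (ext_conj_fun g k) = iota k ^ g.
Proof. exact: (projT2 (cid (ext_conj_subproof g k))). Qed.

Lemma ext_conj_is_aut g : is_aut (ext_conj_fun g).
Proof.
split; last first.
  by move=> x y; apply: (@ext_injI _ _ _ E); rewrite gmulfM !ext_conj_funE gmulfM conjMg.
by exists (ext_conj_fun g^-1) => k; apply: (@ext_injI _ _ _ E);
  rewrite !ext_conj_funE (conjgK, conjgKV).
Qed.

Definition ext_conj (g : G) : Aut K := mk_aut (ext_conj_is_aut g).

Lemma ext_conjE g k : iota (ext_conj g k) = iota k ^ g.
Proof. exact: ext_conj_funE. Qed.

Lemma ext_conjM : {morph ext_conj : g h / g * h}.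
Proof.
move=> g h; apply: aut_eqP => k; rewrite autM; apply: (@ext_injI _ _ _ E).
by rewrite !ext_conjE conjgM.
Qed.

HB.instance Definition _ :=
  isUMagmaMorphism.Build G (Aut K) ext_conj
    (group_monoid_morphism ext_conjM).

(* The chosen preimage of [q] is irrelevant, see [ext_thetaE]. *)
Definition ext_theta (q : Q) : Out K :=
  out_class (ext_conj (projT1 (cid (ext_proj_surj E q)))).

Lemma ext_thetaE (g : G) : ext_theta (rho g) = out_class (ext_conj g).
Proof.
rewrite /ext_theta; case: cid => h /= hg; apply/out_classP.
have /(ext_exact E) [k kE] : rho (h^-1 * g) = 1.
  by rewrite gmulfM -hg -gmulfM mulVg gmulf1.
exists k => //; apply: (mulgI (ext_conj h)); rewrite mulVKg.
apply: aut_eqP => x; rewrite autM /=; apply: (@ext_injI _ _ _ E).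
by rewrite gmulfJ kE !ext_conj_funE -conjgM mulVKg.
Qed.

Lemma ext_thetaM : {morph ext_theta : p q / p * q}.
Proof.
move=> p q; have [g <-] := ext_proj_surj E p; have [h <-] := ext_proj_surj E q.
by rewrite -gmulfM !ext_thetaE -!gmulfM.
Qed.

HB.instance Definition _ :=
  isUMagmaMorphism.Build Q (Out K) ext_theta
    (group_monoid_morphism ext_thetaM).

End ExtensionAction.

(* Main.v *)
(* The delicate point is that a non-icc hyperbolic group [K] has an element
   [z <> 1] with finite [Aut K]-orbit; the image of [z] then has finite
   conjugacy class in [G]. If [FC K] is finite, any [z <> 1] in it will do.
   If not, it contains infinitely many classes, hence elements [x] that are of
   minimal length in their class and arbitrarily long. Such an [x] has
   quasi-geodesic powers, so its centralizer, which has finite index, stays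
   within bounded distance of [<x>]. Thus [<x>] has finite index and, for some
   [N], all [N]-th powers in [K] lie in it. If [f x ^+ N = x ^ a] and
   [f^-1 x ^+ N = x ^ b] then [a b = N ^ 2], which leaves finitely many values
   [f (x ^+ N)].
   For the rest only [FC K = 1] is used: an automorphism with finite range of
   [k |-> (f k)^-1 k] is trivial, and the centralizer of [K] in [G] meets [K]
   trivially, hence embeds in [Q]. *)

Require Import Defs.
From HB Require Import structures.
From mathcomp Require Import all_boot all_order all_algebra.
From mathcomp Require Import boolp classical_sets functions cardinality.
From mathcomp Require Import zify lra.

Set Implicit Arguments.
Unset Strict Implicit.
Unset Printing Implicit Defensive.

Import Order.TTheory GRing.Theory Num.Theory.

Local Open Scope classical_set_scope.
Local Open Scope group_scope.

(** * Elements with finite conjugacy class, and homomorphisms *)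

Lemma FCP (G : groupType) (g : G) : FC G g <-> finite_set (conj_class g).
Proof.
split; last by move=> fin; exists g => //; exists 1; rewrite ?conjg1.
case=> h fin [k _ <-]; apply: sub_finite_set fin => _ [m _ <-].
by exists (k * m); rewrite ?conjgM.
Qed.

Lemma FC1 (G : groupType) : FC G 1.
Proof.
apply/FCP; apply: sub_finite_set (finite_set1 1) => _ [k _ <-].
by rewrite conj1g.
Qed.

Lemma FCM (G : groupType) (g h : G) : FC G g -> FC G h -> FC G (g * h).
Proof.
move=> /FCP fg /FCP fh; apply/FCP.
apply: sub_finite_set (finite_image2 (fun u v => u * v) fg fh).
move=> _ [k _ <-]; exists (g ^ k); first by exists k.
by exists (h ^ k); rewrite ?conjMg //; exists k.
Qed.

Lemma FCV (G : groupType) (g : G) : FC G g -> FC G g^-1.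
Proof.
move=> /FCP fg; apply/FCP.
apply: sub_finite_set (finite_image (fun u => u^-1) fg) => _ [k _ <-].
by exists (g ^ k); rewrite ?conjVg //; exists k.
Qed.

Lemma FC_conj (G : groupType) (g k : G) : FC G g -> FC G (g ^ k).
Proof.
by case=> h fin [m _ <-]; exists h => //; exists (m * k); rewrite ?conjgM.
Qed.

Lemma icc_FC_eq1 (G : groupType) (g : G) : icc G -> FC G g -> g = 1.
Proof. by case=> _ iccG /FCP fin; apply: contrapT => /iccG. Qed.

Lemma FC_morph (G H : groupType) (f : UMagmaMorphism.type G H) g :
  (forall h, exists g, f g = h) -> FC G g -> FC H (f g).
Proof.
move=> f_surj /FCP fin; apply/FCP; apply: sub_finite_set (finite_image f fin).
move=> _ [h _ <-]; have [k <-] := f_surj h.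
by exists (g ^ k); rewrite ?gmulfJ //; exists k.
Qed.

Lemma FC_inj (G H : groupType) (f : UMagmaMorphism.type G H) g :
  injective f -> FC H (f g) -> FC G g.
Proof.
move=> f_inj /FCP fin; apply/FCP.
apply: sub_finite_set (finite_preimage (in2W f_inj) fin) => _ [k _ <-].
by exists (f k); rewrite ?gmulfJ.
Qed.

HB.instance Definition _ (K : groupType) (f : Aut K) :=
  isUMagmaMorphism.Build K K f (group_monoid_morphism (autP f).2).

Lemma autX (K : groupType) (f : Aut K) x n : f (x ^+ n) = f x ^+ n.
Proof. exact: gmulfXn. Qed.

Lemma autXV (K : groupType) (f : Aut K) x n : f (x ^- n) = f x ^- n.
Proof. exact: gmulfXVn. Qed.

Lemma FC_Aut (K : groupType) (f : Aut K) g : FC K g -> FC K (f g).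
Proof.
by apply: FC_morph => h; exists (aut_inv f h); apply: (aut_invK f).2.
Qed.

(** * Length functions with a four-point condition *)

Section HyperbolicLength.
Variables (K : groupType) (l : K -> nat) (D : nat).
Hypothesis l1 : l 1 = 0%N.
Hypothesis lV : forall g, l g^-1 = l g.
Hypothesis lM : forall g h, (l (g * h) <= l g + l h)%N.
(** Gromov's condition for the distance [l (x^-1 * y)], with integer constant and no base point. *)
Hypothesis four_point : forall x y z w,
  (l (x^-1 * z) + l (y^-1 * w) <=
   maxn (l (x^-1 * y) + l (z^-1 * w)) (l (y^-1 * z) + l (x^-1 * w)) + D)%N.
Hypothesis l_split : forall g i, (i <= l g)%N ->
  exists u v, [/\ g = u * v, l u = i & l v = (l g - i)%N].
Hypothesis l_finite : forall r, finite_set [set g | (l g <= r)%N].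

Section LongMinimal.
Variable x : K.
Hypothesis x_min : forall k, (l x <= l (x ^ k))%N.
(** Ample for discarding the unwanted alternative of [four_point] in the estimates on powers. *)
Hypothesis x_long : (4 * D + 2 <= l x)%N.
Hypothesis x_FC : FC K x.

(* Cutting [x = u * v] in the middle, [v * u] is a conjugate of [x]; by minimality
   a geodesic from [u] to [x * u] passes through [x]. *)
Lemma length_sqr : (2 * l x <= l (x ^+ 2) + 2 * D)%N.
Proof.
have [|u [v [xE lu lv]]] := @l_split x (l x)./2; first by lia.
have vu : (l x <= l (v * u))%N.
  by have := x_min u; rewrite conjgE {2}xE -mulgA mulKg.
have := four_point u (x ^+ 2) (x * u) x; have := four_point u 1 (x ^+ 2) x.
have -> : u^-1 * (x * u) = v * u by rewrite {1}xE -mulgA mulKg.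
have -> : (x ^+ 2)^-1 * x = x^-1 by rewrite expg2 invgM -mulgA mulVg mulg1.
have -> : (x * u)^-1 * x = u^-1 by rewrite invgM -mulgA mulVg mulg1.
have -> : u^-1 * x ^+ 2 = v * x by rewrite expg2 {1}xE -mulgA mulKg.
have -> : (x ^+ 2)^-1 * (x * u) = v^-1.
  by rewrite expg2 invgM !mulgA mulgVK {1}xE invgM mulgVK.
have -> : u^-1 * x = v by rewrite xE mulKg.
rewrite !(invg1, mul1g, mulg1) !lV.
lia.
Qed.

(** In the four-point condition, the alternative without [x ^+ n.+2] contradicts the induction
    hypothesis, since [6 * D < 2 * l x]. *)
Lemma length_expS n : (l (x ^+ n) + l x <= l (x ^+ n.+1) + 3 * D)%N.
Proof.
elim: n => [|n IH]; first by rewrite expg0 expg1 l1; lia.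
have := four_point (x ^+ n) 1 (x ^+ n.+2) (x ^+ n.+1).
rewrite !invg1 !mul1g mulg1 lV.
have -> : (x ^+ n)^-1 * x ^+ n.+2 = x ^+ 2 by rewrite -addn2 expgnDr mulKg.
have -> : (x ^+ n)^-1 * x ^+ n.+1 = x by rewrite expgSr mulKg.
have -> : (x ^+ n.+2)^-1 * x ^+ n.+1 = x^-1.
  by rewrite [x ^+ n.+2]expgSr invgM mulgVK.
rewrite lV; have := length_sqr; lia.
Qed.

Lemma length_exp_ge n : (n <= l (x ^+ n))%N.
Proof. by elim: n => // n IH; have := length_expS n; lia. Qed.

(** The stretches from [1] to [x ^+ a.+1] and from [x ^+ a] to [x ^+ (a + b.+1)] overlap in one
    factor [x], which decides between the two alternatives. *)
Lemma length_expD a b :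
  (l (x ^+ a) + l (x ^+ b) <= l (x ^+ (a + b)) + 4 * D)%N.
Proof.
case: b => [|b]; first by rewrite addn0 expg0 l1; lia.
have := four_point 1 (x ^+ (a + b.+1)) (x ^+ a.+1) (x ^+ a).
rewrite !invg1 !mul1g.
have -> : (x ^+ (a + b.+1))^-1 * x ^+ a = (x ^+ b.+1)^-1.
  by rewrite expgnDr invgM mulgVK.
have -> : (x ^+ a.+1)^-1 * x ^+ a = x^-1 by rewrite expgSr invgM mulgVK.
have -> : (x ^+ (a + b.+1))^-1 * x ^+ a.+1 = (x ^+ b)^-1.
  by rewrite addnS -addSn expgnDr invgM mulgVK.
rewrite !lV; have := length_expS a; have := length_expS b; lia.
Qed.

Lemma length_expSl n : (l (x ^+ n.+1) <= l (x ^+ n) + l x)%N.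
Proof. by rewrite expgSr; apply: lM. Qed.

(* [1] is a point of the quasi-geodesic [n |-> x ^+ n] nearest to [h^-1], so a
   path from [h^-1] to [x ^+ n] passes near [1]. *)
Lemma length_mul_exp h n :
  (forall m, l h <= l (h * x ^+ m))%N ->
  (l h + l (x ^+ n) <= l (h * x ^+ n) + 10 * D + 2 * l x)%N.
Proof.
(* [t] is twice the Gromov product of [h^-1] and [x ^+ n] at [1], and [m] will be the last index
   with [x ^+ m] within [t / 2] of [1]. One alternative then gives [l (x ^+ m) <= 5 * D], the other
   [t <= 2 * D]. *)
move=> h_min; set t := (l h + l (x ^+ n) - l (h * x ^+ n))%N.
have t_le : (t <= 2 * l (x ^+ n))%N.
  have := lM (h * x ^+ n) (x ^+ n)^-1; rewrite mulgK lV /t; lia.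
have ex0 : exists m, (m <= n)%N && (2 * l (x ^+ m) <= t)%N.
  by exists 0%N; rewrite expg0 l1.
have ub m : (m <= n)%N && (2 * l (x ^+ m) <= t)%N -> (m <= n)%N by case/andP.
case: (ex_maxnP ex0 ub) => m /andP[mn mt] m_max.
have t_lt : (t <= 2 * l (x ^+ m) + 2 * l x)%N.
  have [->|nm] := eqVneq m n; first by lia.
  have := m_max m.+1; have := length_expSl m; lia.
have := four_point (x ^+ m) (x ^+ n) h^-1 1.
rewrite !invgK !mulg1 !lV.
have -> : l ((x ^+ m)^-1 * h^-1) = l (h * x ^+ m) by rewrite -invgM lV.
have -> : l ((x ^+ n)^-1 * h^-1) = l (h * x ^+ n) by rewrite -invgM lV.
have -> : (x ^+ m)^-1 * x ^+ n = x ^+ (n - m).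
  by rewrite -{1}(subnKC mn) expgnDr mulKg.
have := length_expD m (n - m); rewrite subnKC //.
have := h_min m; rewrite /t in mt t_lt t_le *; lia.
Qed.

(** In the parallelogram [1], [h], [h * x ^+ n], [x ^+ n] both diagonals are nearly as long as two
    adjacent sides together, so the shorter side is bounded. Taking [n = l h] makes [h] that
    side. *)
Lemma length_centralizer_min h : commute h x ->
    (forall m, l h <= l (h * x ^+ m))%N ->
    (forall m, l h <= l (h * x ^- m))%N ->
  (l h <= 11 * D + 2 * l x)%N.
Proof.
move=> hx h_min h_minV.
have [n nE] : exists n, n = l h by exists (l h).
have hV_min m : (l h^-1 <= l (h^-1 * x ^+ m))%N.
  rewrite lV -(lV (_ * _)) invgM invgK.
  suff -> : x ^- m * h = h * x ^- m by [].
  by apply/commute_sym/commuteV/commuteX.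
have A := length_mul_exp n h_min.
have B : (l h^-1 + l (x ^+ n) <= l (h^-1 * x ^+ n) + 10 * D + 2 * l x)%N.
  exact: length_mul_exp hV_min.
have := four_point 1 h (h * x ^+ n) (x ^+ n).
rewrite !invg1 !mul1g mulKg.
have -> : (h * x ^+ n)^-1 * x ^+ n = h^-1.
  by rewrite (commuteX n hx) invgM mulgVK.
have := length_exp_ge n; move: A B; rewrite !lV; lia.
Qed.

Lemma long_exp_eq1 n : x ^+ n = 1 -> n = 0%N.
Proof.
move=> xn; apply/eqP; rewrite -leqn0 -l1 -xn.
exact: length_exp_ge.
Qed.

Lemma long_expI : injective (fun n => x ^+ n).
Proof.
move=> m n; wlog mn : m n / (m <= n)%N => [W|].
  by case/orP: (leq_total m n) => /W// W' /esym/W' ->.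
move=> /= /esym; rewrite -{1}(subnKC mn) expgnDr -{2}[x ^+ m]mulg1 => /mulgI.
by move/long_exp_eq1; lia.
Qed.

(** * Finite index of the cyclic group of [x] *)

Lemma centralizer_near_cycle h : commute h x ->
  exists a b, (l (h * x ^+ a * x ^- b) <= 11 * D + 2 * l x)%N.
Proof.
move=> hx.
(* A shortest element of the coset of [h] is taken; pairs [a], [b] encode the integer exponents
   [a - b]. *)
have exP : exists n, `[< exists a b, n = l (h * x ^+ a * x ^- b) >].
  by exists (l (h * x ^+ 0 * x ^- 0)); apply/asboolP; exists 0%N, 0%N.
case: (ex_minnP exP) => n /asboolP[a [b ->]] minh; exists a, b.
have xV m n' : commute (x ^- m) (x ^+ n').
  by apply/commute_sym/commuteV/commuteX/commute_sym/commuteX.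
apply: length_centralizer_min.
- apply/commute_sym/commuteM; first by apply/commuteM/commuteX.
  by apply/commuteV/commuteX.
- move=> m; apply: minh; apply/asboolP; exists (a + m)%N, b.
  by rewrite -!mulgA (xV b m) expgnDr !mulgA.
- move=> m; apply: minh; apply/asboolP; exists a, (m + b)%N.
  by rewrite expgnDr invgM !mulgA.
Qed.

(** [phi] picks a conjugator for each of the finitely many conjugates of [x], so [k] differs from
    [phi (x ^ k)] by an element of the centralizer, which lies near the powers of [x]. *)
Lemma cycle_cofinite : exists s : seq K,
  forall k, exists a b c, c \in s /\ k = x ^+ a * x ^- b * c.
Proof.
have /FCP fin := x_FC.
have [phi phiE] : {phi : K -> K | forall k, x ^ phi (x ^ k) = x ^ k}.
  apply: cid; have /choice[phi H] :
      forall y, exists z, (exists k, x ^ k = y) -> x ^ z = y.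
    move=> y; have [[k <-]|nk] := pselect (exists k, x ^ k = y).
      by exists k.
    by exists 1.
  by exists phi => k; apply: H; exists k.
have /finite_seqP[s sE] :=
  finite_image2 (fun h c => h * phi c) (l_finite (11 * D + 2 * l x)) fin.
exists s => k; pose h := k * (phi (x ^ k))^-1.
have hx : commute h x.
  by rewrite /commute [RHS]conjgC conjgM -{1}(phiE k) conjgK.
have [a [b hab]] := centralizer_near_cycle hx.
exists b, a, (h * x ^+ a * x ^- b * phi (x ^ k)); split.
  suff : [set` s] (h * x ^+ a * x ^- b * phi (x ^ k)) by [].
  rewrite -sE; exists (h * x ^+ a * x ^- b) => //.
  by exists (x ^ k) => //; exists k.
have -> : h * x ^+ a * x ^- b = x ^+ a * x ^- b * h.
  rewrite -mulgA; apply: commuteM; first exact: commuteX.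
  by apply/commuteV/commuteX.
by rewrite !mulgA !mulgVK mulgV mul1g.
Qed.

Lemma exp_in_cycle : exists2 N, (0 < N)%N &
  forall y, exists a, y ^+ N = x ^+ a \/ y ^+ N = x ^- a.
Proof.
have [s sP] := cycle_cofinite; exists (size s)`!; first exact: fact_gt0.
move=> y.
have /choice[c cP] : forall i, exists c,
    exists a b, c \in s /\ y ^+ i = x ^+ a * x ^- b * c.
  by move=> i; have [a [b [c ?]]] := sP (y ^+ i); exists c, a, b.
(* Pigeonhole: two of the powers [y ^+ 0], ..., [y ^+ size s] share a coset representative, and
   [j - i] divides the factorial. *)
have [i [j [ij js cij]]] : exists i j,
    [/\ (i < j)%N, (j <= size s)%N & c i = c j].
  have : ~~ uniq [seq c i | i <- iota 0 (size s).+1].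
    apply/negP => /(@uniq_leq_size _ _ s); rewrite size_map size_iota ltnn.
    move=> sub; suff: false by [].
    by apply: sub => _ /mapP[i _ ->]; have [a [b []]] := cP i.
  move=> /(uniqPn 1)[i [j [ij]]]; rewrite size_map size_iota => js.
  rewrite !(nth_map 0%N) ?size_iota ?(ltn_trans ij) //.
  rewrite !nth_iota ?(ltn_trans ij) //.
  by exists i, j.
have [a [b [_ yi]]] := cP i; have [a' [b' [_ yj]]] := cP j.
have xC m n : commute (x ^+ m) (x ^+ n) by exact: commuteX2.
have xVC m n : commute (x ^- m) (x ^+ n).
  exact/commute_sym/commuteV/xC.
have yji : y ^+ (j - i) = x ^+ (a' + b) * x ^- (b' + a).
  rewrite expgnFr ?(ltnW ij) // yi yj cij [in X in _ * X]invgM mulgA mulgK.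
  rewrite invgM invgK -!mulgA [x ^- b' * _]mulgA xVC !mulgA -!expgnDr.
  by rewrite -!mulgA -invgM -expgnDr [(a + _)%N]addnC.
have /dvdnP[q ->] : (j - i %| (size s)`!)%N by apply: dvdn_fact; lia.
rewrite mulnC expgnA yji expgMn; last exact/commuteV/xC.
rewrite expVgn -!expgnA.
case: (leqP ((a' + b) * q) ((b' + a) * q)) => [|/ltnW] /subnK/esym E.
  exists ((b' + a) * q - (a' + b) * q)%N; right.
  by rewrite {1}E expgnDr invgM mulgA mulgV mul1g.
exists ((a' + b) * q - (b' + a) * q)%N; left.
by rewrite {1}E expgnDr mulgK.
Qed.

Lemma cycle_finite_Aut_orbit : exists2 z : K, z <> 1 &
  finite_set [set f z | f in [set: Aut K]].
Proof.
have [N N0 xN] := exp_in_cycle; exists (x ^+ N).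
  by move/long_exp_eq1; lia.
pose I := [set a | (a <= N * N)%N].
have finI : finite_set I by apply: sub_finite_set (finite_II (N * N).+1) => a.
have : finite_set ([set x ^+ a | a in I] `|` [set x ^- a | a in I]).
  by rewrite finite_setU; split; apply: finite_image.
apply: sub_finite_set => _ [f _ <-].
have [a fa] := xN (f x); have [b fb] := xN (aut_inv f x).
suff aN : (a <= N * N)%N.
  by rewrite autX; case: fa => ->; [left|right]; exists a.
(* Both sides compute [f (aut_inv f x ^+ N) ^+ N]. *)
have ab : x ^+ (N * N) = x ^+ (a * b) \/ x ^+ (N * N) = x ^- (a * b).
  have xNE : x ^+ N = f (aut_inv f x ^+ N).
    by rewrite autX; congr (_ ^+ _); apply/esym; apply: (aut_invK f).2.
  rewrite expgnA {1 2}xNE.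
  case: fb => ->; rewrite ?(autX, autXV) ?expVgn expgnAC; case: fa => ->;
    rewrite ?expVgn ?invgK -expgnA; by [left|right].
have NN : (0 < N * N)%N by rewrite muln_gt0 N0.
case: ab => [/long_expI/= E|].
  by move: NN; rewrite E; case: (b) => [|b']; rewrite ?muln0 // leq_pmulr.
(* Opposite signs would give [x] finite order. *)
move=> /(congr1 (fun y => y * x ^+ (a * b))); rewrite mulVg -expgnDr.
by move/long_exp_eq1; lia.
Qed.

End LongMinimal.

End HyperbolicLength.

(** * Word length in a finitely generated group *)

Lemma rev_inv_prod (K : groupType) (w : seq K) :
  \prod_(s <- rev [seq s^-1 | s <- w]) s = (\prod_(s <- w) s)^-1.
Proof.
elim: w => [|s w IH]; first by rewrite !big_nil invg1.
by rewrite map_cons rev_cons -cats1 big_cat big_seq1 big_cons invgM IH.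
Qed.

Section WordLength.
Variables (K : groupType) (S : seq K) (genS : generating S).
Local Notation l := (word_length genS).

Lemma word_length_word g :
  exists w, [/\ is_word S w, size w = l g & \prod_(s <- w) s = g].
Proof.
by rewrite /word_length; case: ex_minnP => n /asboolP[w [? ? ?]] _; exists w.
Qed.

Lemma word_length_le w : is_word S w -> (l (\prod_(s <- w) s) <= size w)%N.
Proof.
move=> Sw; rewrite /word_length; case: ex_minnP => n _; apply.
by apply/asboolP; exists w.
Qed.

Lemma word_length1 : l 1 = 0%N.
Proof. by have := @word_length_le [::] isT; rewrite big_nil leqn0 => /eqP. Qed.

Lemma word_lengthV g : l g^-1 = l g.
Proof.
have le h : (l h^-1 <= l h)%N.
  have [w [Sw <- <-]] := word_length_word h.
  rewrite -rev_inv_prod -(size_map (fun s => s^-1)) -size_rev.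
  apply: word_length_le.
  rewrite /is_word all_rev all_map; apply: sub_all Sw => s /=.
  by rewrite invgK orbC.
by apply/eqP; rewrite eqn_leq le -{1}(invgK g) le.
Qed.

Lemma word_lengthM g h : (l (g * h) <= l g + l h)%N.
Proof.
have [v [Sv <- vg]] := word_length_word g.
have [w [Sw <- wh]] := word_length_word h.
rewrite -{1}vg -{1}wh -big_cat -size_cat; apply: word_length_le.
by rewrite /is_word all_cat; apply/andP.
Qed.

(** A shortest word is cut after [i] letters; by subadditivity neither piece can be shortened. *)
Lemma word_length_split g i : (i <= l g)%N ->
  exists u v, [/\ g = u * v, l u = i & l v = (l g - i)%N].
Proof.
have [w [Sw ws wg]] := word_length_word g => ig.
have [Su Sv] : is_word S (take i w) /\ is_word S (drop i w).
  by apply/andP; rewrite -all_cat cat_take_drop.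
have := word_length_le Su; have := word_length_le Sv.
rewrite size_takel ?ws // size_drop ws.
set u := \prod_(s <- take i w) s; set v := \prod_(s <- drop i w) s.
have gE : g = u * v by rewrite -big_cat cat_take_drop.
exists u, v; have := word_lengthM u v; rewrite -gE.
by split=> //; lia.
Qed.

Lemma finite_word_ball r : finite_set [set g | (l g <= r)%N].
Proof.
elim: r => [|r IH].
  apply: (@sub_finite_set _ _ [set 1]); last exact: finite_set1.
  move=> g /=; have [w [_ <- <-]] := word_length_word g.
  by rewrite leqn0 => /nilP->; rewrite big_nil.
(* The extra letter [1] serves the empty word. *)
have fin : finite_set [set` 1 :: S ++ [seq s^-1 | s <- S]] by apply: finite_seq.
apply: sub_finite_set (finite_image2 (fun s g => s * g) fin IH).
move=> g /=; have [[|s w] [Sw <- <-]] := word_length_word g.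
  exists 1; first by rewrite /= mem_head.
  by exists 1; rewrite ?big_nil ?mulg1 //= word_length1.
move: Sw => /= /andP[Ss Sw] wr; exists s.
  rewrite /= inE mem_cat; case/orP: Ss => [->|Ss]; first by rewrite orbT.
  by apply/or3P/Or33/mapP; exists s^-1; rewrite ?invgK.
exists (\prod_(t <- w) t); last by rewrite big_cons.
exact: leq_trans (word_length_le Sw) _.
Qed.

(** Doubling clears the halves and the distances to the base point [w] partly cancel; [D] is an
    integer above [2 * delta]. *)
Lemma word_length_four_point : gromov_hyperbolic (word_dist genS) ->
  exists D, forall x y z w : K,
    (l (x^-1 * z) + l (y^-1 * w) <=
     maxn (l (x^-1 * y) + l (z^-1 * w)) (l (y^-1 * z) + l (x^-1 * w)) + D)%N.
Proof.
case=> delta delta0 hyp; exists (Num.bound (2%:R * delta)%R) => x y z w.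
have := hyp w x y z; rewrite /gromov_product /word_dist.
have := archi_boundP (mulr_ge0 (ler0n _ 2) delta0).
move: (Num.bound _) => D hD.
rewrite -(ler_nat rat) !(natrD, natr_max).
rewrite lerBlDr ge_min => /orP[] H; rewrite -lerBlDr le_max; apply/orP.
  by left; lra.
by right; lra.
Qed.

End WordLength.

(** * Finite automorphism orbits in hyperbolic groups *)

Lemma hyperbolic_finite_Aut_orbit (K : groupType) :
    word_hyperbolic K -> nontrivial_group K -> ~ icc K ->
  exists2 z : K, z <> 1 & finite_set [set f z | f in [set: Aut K]].
Proof.
move=> [S [genS /word_length_four_point[D four_point]]] ntK nicc.
have [z z1 /FCP zFC] : exists2 z : K, z <> 1 & finite_set (conj_class z).
  apply: contrapT => nz; apply: nicc; split=> // g g1 fin; apply: nz.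
  by exists g.
have [FCfin|FCinf] := pselect (finite_set (FC K)).
  exists z => //; apply: sub_finite_set FCfin => _ [f _ <-].
  exact: FC_Aut.
set l := word_length genS.
have [y [yFC y_long]] : exists y,
    FC K y /\ forall k : K, (4 * D + 2 <= l (y ^ k)%g)%N.
  (* Otherwise every class in [FC K] meets a fixed finite ball, and [FC K] is a finite union of
     finite classes. *)
  apply: contrapT => ny; apply: FCinf.
  have fin := finite_word_ball genS (4 * D + 2).
  have : finite_set
      (\bigcup_(g in [set g | (l g <= 4 * D + 2)%N] `&` FC K) conj_class g).
    apply: bigcup_finite; first exact: finite_setIl.
    by move=> g [_ /FCP].
  apply: sub_finite_set => g gFC.
  have [k gk] : exists k, ~ (4 * D + 2 <= l (g ^ k)%g)%N.
    by apply: contrapT => nk; apply: ny; exists g; split=> // k;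
       apply: contrapT => ?; apply: nk; exists k.
  exists (g ^ k); first by split; [move=> /=; lia|apply: FC_conj].
  by exists k^-1; rewrite ?conjgK.
have exP : exists n, `[< exists k, n = l (y ^ k) >].
  by exists (l (y ^ 1)); apply/asboolP; exists 1.
case: (ex_minnP exP) => n /asboolP[k nE] n_min.
apply: (@cycle_finite_Aut_orbit K l D _ _ _ four_point _ _ (y ^ k)) => //.
- exact: word_length1.
- exact: word_lengthV.
- exact: word_lengthM.
- exact: word_length_split.
- exact: finite_word_ball.
- move=> m; rewrite -conjgM -nE; apply: n_min; apply/asboolP.
  by exists (k * m).
- exact: FC_conj.
Qed.

(* With [c k = (f k)^-1 * k] one has [c k ^ m = (c m)^-1 * c (k * m)]. *)
Lemma icc_aut_eq1 (K : groupType) (f : Aut K) :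
  icc K -> finite_set [set (f k)^-1 * k | k in [set: K]] -> f = 1.
Proof.
move=> iccK fin; apply: aut_eqP => k; have fM := (autP f).2.
apply: (mulgI (f k)^-1); rewrite mulVg; apply/esym/(icc_FC_eq1 iccK)/FCP.
apply: sub_finite_set (finite_image2 (fun u v => u^-1 * v) fin fin).
move=> _ [m _ <-]; exists ((f m)^-1 * m); first by exists m.
exists ((f (k * m))^-1 * (k * m)); first by exists (k * m).
by rewrite fM /conjg !invgM invgK !mulgA mulgK.
Qed.

(** * The conjugation action in an extension *)

Section Extension.
Variables (K G Q : groupType) (E : group_extension K G Q).
Local Notation iota := (ext_inj E).
Local Notation rho := (ext_proj E).

(** [G] acts on [K] by automorphisms, so the class of [iota z] lies in the image of the orbit. *)
Lemma ext_inj_FC (z : K) :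
  finite_set [set f z | f in [set: Aut K]] -> FC G (iota z).
Proof.
move=> fin; apply/FCP.
apply: sub_finite_set (finite_image iota fin) => _ [g _ <-].
by exists (ext_conj E g z); [exists (ext_conj E g)|rewrite ext_conjE].
Qed.

(** The quotients [(k ^ g)^-1 * k] are the commutators [g^-1 * g ^ k], finite in number. *)
Lemma FC_ext_conj_eq1 g : icc K -> FC G g -> ext_conj E g = 1.
Proof.
move=> iccK /FCP fin; apply: icc_aut_eq1 => //.
have {}fin := finite_image (fun h => g^-1 * h) fin.
apply: sub_finite_set (finite_preimage (in2W (@ext_injI _ _ _ E)) fin).
move=> _ [k _ <-]; exists (g ^ iota k); first by exists (iota k).
by rewrite gmulfM gmulfV ext_conjE /conjg !invgM !invgK !mulgA.
Qed.

(** [g^-1 * h] comes from a central element of [K], which is trivial as [K] is icc. *)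
Lemma ext_conj_eq1_inj g h : icc K ->
  ext_conj E g = 1 -> ext_conj E h = 1 -> rho g = rho h -> g = h.
Proof.
move=> iccK cg ch gh.
have /(ext_exact E)[z zE] : rho (g^-1 * h) = 1.
  by rewrite gmulfM gmulfV gh mulVg.
suff z1 : z = 1 by apply: (mulgI g^-1); rewrite mulVg -zE z1 gmulf1.
apply: icc_FC_eq1 => //; apply/FCP.
apply: sub_finite_set (finite_set1 z) => _ [k _ <-] /=.
have cz : ext_conj E (iota z) = 1.
  rewrite zE; transitivity ((ext_conj E g)^-1 * ext_conj E h).
    by rewrite gmulfM gmulfV.
  by rewrite cg ch mulVg.
have kz : k ^ z = k.
  by apply: (@ext_injI _ _ _ E); rewrite gmulfJ -ext_conjE cz.
by rewrite conjgE -{2}kz conjgE mulVKg mulKg.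
Qed.

(** The class of [g] stays in the centralizer of [K], where [rho] is injective. *)
Lemma FC_ext_proj g : icc K -> ext_conj E g = 1 -> FC Q (rho g) -> FC G g.
Proof.
move=> iccK cg /FCP fin; apply/FCP.
have cJ h : conj_class g h -> ext_conj E h = 1.
  move=> [k _ <-]; transitivity (ext_conj E g ^ ext_conj E k).
    exact: gmulfJ.
  by rewrite cg conj1g.
have inj : {in conj_class g &, injective rho}.
  by move=> h k /set_mem/cJ ch /set_mem/cJ ck; apply: ext_conj_eq1_inj.
rewrite -(eq_finite_set (inj_card_eq inj)); apply: sub_finite_set fin.
by move=> _ [_ [k _ <-] <-]; exists (rho k); rewrite ?gmulfJ.
Qed.

(** Any lift of [q] acts on [K] as some inner [k]; dividing it by [iota k] makes it act
    trivially. *)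
Lemma ext_theta_eq1 q : ext_theta E q = 1 ->
  exists2 g, rho g = q & ext_conj E g = 1.
Proof.
have [g <-] := ext_proj_surj E q; rewrite ext_thetaE => /out_classP.
rewrite mulg1 => /InnV; rewrite invgK => -[k _ kE].
exists (g * (iota k)^-1).
  have -> : rho (g / iota k) = rho g / rho (iota k) by rewrite gmulfM gmulfV.
  have -> : rho (iota k) = 1 by apply/(ext_exact E); exists k.
  by rewrite invg1 mulg1.
apply: aut_eqP => z; apply: (@ext_injI _ _ _ E).
rewrite ext_conjE conjgM -ext_conjE -kE -gmulfV -gmulfJ.
by congr (iota _); apply: conjgK.
Qed.

End Extension.

Theorem theorem4 (K G Q : groupType) (E : group_extension K G Q)
    (hK : word_hyperbolic K) (ntK : nontrivial_group K) :
  icc G <-> icc K /\ set_inj (FC Q) (ext_theta E).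
Proof.
have iota_neq1 z : z <> 1 -> ext_inj E z <> 1.
  by move=> z1 /eqP; rewrite gmulf_eq1 => [/eqP//|]; apply: ext_injI.
split=> [iccG|[iccK thetaI]].
  have iccK : icc K.
    apply: contrapT => /(hyperbolic_finite_Aut_orbit hK ntK)[z /iota_neq1 z1].
    by move=> /(ext_inj_FC E)/(icc_FC_eq1 iccG).
  split=> // p q /set_mem FCp /set_mem FCq pq.
  (* [p * q^-1] lies in [FC Q] and in the kernel of [theta]; its lift centralizing [K] lies in
     [FC G], hence is trivial. *)
  have [|g gE cg] := @ext_theta_eq1 _ _ _ E (p * q^-1).
    transitivity (ext_theta E p * (ext_theta E q)^-1).
      by rewrite gmulfM gmulfV.
    by rewrite pq mulgV.
  apply/divg1_eq; rewrite -gE (_ : g = 1) ?gmulf1 //.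
  apply: icc_FC_eq1 => //; apply: FC_ext_proj cg _ => //.
  by rewrite gE; apply/FCM/FCV.
split; first by have [k /iota_neq1] := ntK; exists (ext_inj E k).
move=> g g1 /FCP FCg; apply: g1.
(* [g] acts trivially on [K], so injectivity of [theta] on [FC Q] puts [g] in [K], and then in
   [FC K]. *)
have cg := FC_ext_conj_eq1 E iccK FCg.
have /(ext_exact E)[z zE] : ext_proj E g = 1.
  apply: thetaI; rewrite ?inE.
  - by apply: FC_morph FCg; apply: ext_proj_surj.
  - exact: FC1.
  - by rewrite ext_thetaE cg [RHS]gmulf1.
rewrite -zE (_ : z = 1) ?gmulf1 //; apply: icc_FC_eq1 => //.
by apply: (FC_inj (@ext_injI _ _ _ E)); rewrite zE.
Qed.
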